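(* Let $I$ be any set and let $(E_i)_{i\in I}$ be any collection of sets. For any family $(\mathcal{A}_j)_{j\in J}$ of subsets of $\mathcal{P}(I)$, $$\bigcap_{j\in J}\mathcal{F}_{\hat{\mathcal{A}}_j}=\mathcal{F}_{\bigcap_{j\in J}\hat{\mathcal{A}}_j}.$$
   Context: $\mathcal{P}(I)$ is the set of all subsets of $I$. For $a\subseteq I$, $E_a=\prod_{i\in a}E_i$ (with $E_\emptyset$ a one-point set), and for $x\in E_I$, $x_a\in E_a$ is the projection of $x$ onto $E_a$. For $\mathcal{A}\subseteq\mathcal{P}(I)$, its lower set is $\hat{\mathcal{A}}=\{a\in\mathcal{P}(I): \exists b\in\mathcal{A},\ a\subseteq b\}$. Generalized factorisation space: for $\mathcal{A}\subseteq\mathcal{P}(I)$, $\mathcal{F}_{\mathcal{A}}$ is the set of functions $f:E_I\to\mathbb{R}_{>0}$ for which there are an integer $n\geq 0$, finite sets $a_1,\dots,a_n\in\hat{\mathcal{A}}$ and functions $f_k:E_{a_k}\to\mathbb{R}_{>0}$ ($1\le k\le n$) such that $f(x)=\prod_{k=1}^n f_k(x_{a_k})$ for all $x\in E_I$ (the empty product being the constant $1$). In particular $\mathcal{F}_{\mathcal{A}}=\mathcal{F}_{\hat{\mathcal{A}}}$. Convention: if $J=\emptyset$, the intersection of lower sets is $\mathcal{P}(I)$ and the intersection of factorisation spaces is $\mathcal{F}_{\mathcal{P}(I)}$. *)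

(* Defs.v *)
From mathcomp Require Import all_boot all_order all_algebra.
From mathcomp Require Import all_classical all_reals.

Set Implicit Arguments.
Unset Strict Implicit.
Unset Printing Implicit Defensive.

Import Order.TTheory GRing.Theory Num.Theory.
Local Open Scope classical_set_scope.
Local Open Scope ring_scope.

Definition lower_set (I : Type) (A : set (set I)) : set (set I) :=
  [set a | exists2 b, A b & a `<=` b].

(* [E_a] is the product of the [E i] over the subtype of [a]; the full product
   [E_I] is represented directly by the dependent functions [forall i, E i]. *)
Definition subprod (I : Type) (E : I -> Type) (a : set I) : Type :=
  forall i : a, E (val i).

Definition subprod_proj (I : Type) (E : I -> Type) (a : set I)
  (x : forall i, E i) : subprod E a := fun i => x (val i).
Arguments subprod_proj {I E} a x.

(* Functions with values in the positive reals are represented as [R]-valued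
   functions that are positive everywhere. *)
Definition factorisation_space (R : realType) (I : Type) (E : I -> Type)
    (A : set (set I)) : set ((forall i, E i) -> R) :=
  [set f : (forall i, E i) -> R | (forall x, 0 < f x) /\
    exists (n : nat) (a : 'I_n -> set I)
           (g : forall k : 'I_n, subprod E (a k) -> R),
      [/\ forall k, finite_set (a k),
          forall k, lower_set A (a k),
          forall k y, 0 < g k y &
          forall x, f x = \prod_(k < n) g k (subprod_proj (a k) x)]].
Arguments factorisation_space R {I} E A.

(* Intersection of a family of subsets, with the convention that the
   intersection of the empty family is [U]. *)
Definition bigcap_or (T J : Type) (U : set T) (F : J -> set T) : set T :=
  if `[< inhabited J >] then \bigcap_j F j else U.

(* Main.v *)
Require Import Defs.
From mathcomp Require Import all_boot all_order all_algebra.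
From mathcomp Require Import all_classical all_reals.

(** The right-hand side is contained in the left-hand side because
    factorisation spaces increase with the family of sets.  For the other
    inclusion, fix a reference point [x0] of [E_I] (if [E_I] is empty there is
    only one function on it).  For a coordinate [i], let [reset i x] be [x] with
    its [i]-th coordinate replaced by that of [x0], and write
      f = (f \o reset i) * (f / (f \o reset i)).
    Both operations are multiplicative, so they act on a factorisation factor by
    factor: the first one removes [i] from the sets of the factors, whereas the
    second one turns every factor that does not involve [i] into [1] and leaves
    the sets of the other factors unchanged.

    A function in the intersection depends on finitely many coordinates only.
    Splitting along each of them in turn yields a finite product of functions;
    the piece obtained by taking quotients exactly along the coordinates of
    [b] depends on [b] alone, and for every [j] it is a product of factors on
    sets of the [j]-th lower set that contain [b].  If the piece is not
    constantly [1], then for every [j] there is such a set, hence [b] belongs to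
    every lower set, and the piece is a single admissible factor of the
    intersection ([factors_bigcap_above]).  This is the multiplicative form of
    the interaction decomposition by Moebius inversion; since the pieces do not
    depend on [j], the index set [J] may be infinite. *)

Set Implicit Arguments.
Unset Strict Implicit.
Unset Printing Implicit Defensive.

Local Open Scope classical_set_scope.

(** * Finite products of positive factors *)

Section Factorisation.
Import Order.TTheory GRing.Theory Num.Theory.
Local Open Scope ring_scope.

Variables (R : realType) (I : Type) (E : I -> Type).
Local Notation EI := (forall i, E i).
Implicit Types (f g : EI -> R) (a b s : set I) (C : set (set I)).

Definition depends_on a f :=
  forall x y : EI, (forall i, a i -> x i = y i) -> f x = f y.

Lemma depends_on_subset a b f : a `<=` b -> depends_on a f -> depends_on b f.
Proof. by move=> ab fa x y xy; apply: fa => i /ab; apply: xy. Qed.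

(** Finite products of positive factors, kept as functions on the whole product
    that depend on a finite set of [C].  Unlike in [factorisation_space], no
    dependent type mentions the sets and [C] is not replaced by its lower set:
    the decomposition uses families of sets that all contain a given set. *)
Inductive factors C : (EI -> R) -> Prop :=
| factors1 : factors C (fun=> 1)
| factors_single a f : finite_set a -> C a -> (forall x, 0 < f x) ->
    depends_on a f -> factors C f
| factorsM f g : factors C f -> factors C g -> factors C (fun x => f x * g x).

Lemma factors_gt0 C f : factors C f -> forall x, 0 < f x.
Proof. by elim=> // {}f g _ f0 _ g0 x; rewrite mulr_gt0. Qed.

Lemma factors_prod C n (F : 'I_n -> EI -> R) :
  (forall k, factors C (F k)) -> factors C (fun x => \prod_(k < n) F k x).
Proof.
elim: n F => [|n IHn] F CF.
  by under eq_fun do rewrite big_ord0; apply: factors1.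
under eq_fun do rewrite big_ord_recr.
exact: (factorsM (IHn (fun k => F (widen_ord (leqnSn n) k)) _)).
Qed.

Lemma factors_finite_support C f :
  factors C f -> exists2 s, finite_set s & depends_on s f.
Proof.
elim=> [|a {}f fina _ _ fa|{}f g _ [s fins fs] _ [t fint gt]].
- by exists set0.
- by exists a.
- exists (s `|` t); first by rewrite finite_setU.
  move=> x y xy.
  by rewrite (fs x y) ?(gt x y) // => i ?; apply: xy; [right|left].
Qed.

Lemma factors_one_or_nonempty C f : factors C f -> f = (fun=> 1) \/ C !=set0.
Proof.
elim=> [|a {}f _ Ca _ _|{}f g _ [-> _ [->|]|]]; try by [left|right|right; exists a].
by left; apply/funext => x; rewrite mulr1.
Qed.

(** * Agreement with the factorisation spaces *)

(** Reading off [f] at any preimage is legitimate when [f] depends on [a] only.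
    The projection need not be onto (another fibre may be empty), whence the
    default value. *)
Definition descend a f (y : subprod E a) : R :=
  if pselect (exists x : EI, subprod_proj a x = y) is left ex
  then f (projT1 (cid ex)) else 1.

Lemma descend_gt0 a f : (forall x, 0 < f x) -> forall y : subprod E a,
  0 < descend f y.
Proof. by move=> f0 y; rewrite /descend; case: pselect. Qed.

Lemma descendK a f x : depends_on a f -> descend f (subprod_proj a x) = f x.
Proof.
move=> fa; rewrite /descend; case: pselect => [ex|[]]; last by exists x.
case: cid => z /= zx; apply: fa => i ai.
exact: (congr1 (fun y : subprod E a => y (SigSub (mem_set ai))) zx).
Qed.

Lemma factors_prodP C f : factors C f -> exists n (a : 'I_n -> set I)
    (F : 'I_n -> EI -> R), (forall k, [/\ finite_set (a k), C (a k),
      forall x, 0 < F k x & depends_on (a k) (F k)]) /\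
  forall x, f x = \prod_(k < n) F k x.
Proof.
elim=> [|a {}f fina Ca f0 fa|{}f g _ [n [a [F [FP fF]]]] _ [m [b [G [GP gG]]]]].
- exists 0%N, (fun=> set0), (fun=> fun=> 1).
  by split=> [[]//|x]; rewrite big_ord0.
- exists 1%N, (fun=> a), (fun=> f).
  by split=> // x; rewrite big_ord_recl big_ord0 mulr1.
- exists (n + m)%N, (fun k : 'I_(n + m) => match fintype.split k with inl i => a i | inr j => b j end),
    (fun k : 'I_(n + m) => match fintype.split k with inl i => F i | inr j => G j end).
  split=> [k|x]; first by case: (fintype.split k).
  rewrite fF gG big_split_ord /=.
  congr (_ * _); apply: eq_bigr => k _.
    by rewrite (unsplitK (inl k)).
  by rewrite (unsplitK (inr k)).
Qed.

Lemma factorisation_spaceE C :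
  factorisation_space R E C = [set f | factors (lower_set C) f].
Proof.
apply/seteqP; split=> f /=.
  move=> [_ [n [a [g [fina Ca g0 fg]]]]].
  rewrite (_ : f = fun x => \prod_(k < n) g k (subprod_proj (a k) x)); last first.
    exact/funext.
  apply: factors_prod => k; apply: (@factors_single _ (a k)) => // x y xy.
  by congr (g k _); apply: functional_extensionality_dep => i; apply: xy (set_valP i).
move=> Cf; split; first exact: factors_gt0 Cf.
have [n [a [F [FP fF]]]] := factors_prodP Cf.
exists n, a, (fun k => descend (F k)); split=> [k|k|k|x].
- by case: (FP k).
- by case: (FP k).
- by apply: descend_gt0; case: (FP k).
- by rewrite fF; apply: eq_bigr => k _; rewrite descendK//; case: (FP k).
Qed.

Lemma lower_set_bigcap (J : Type) (A : J -> set (set I)) :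
  lower_set (\bigcap_j lower_set (A j)) = \bigcap_j lower_set (A j).
Proof.
apply/seteqP; split=> [a [b bA ab] j _|a aA]; last by exists a.
by have [c Ac bc] := bA j Logic.I; exists c => //; apply: subset_trans bc.
Qed.

Lemma lower_set_idem C : lower_set (lower_set C) = lower_set C.
Proof.
apply/seteqP; split=> [a [b [c Cc bc] ab]|a Ca]; last by exists a.
by exists c => //; apply: subset_trans bc.
Qed.

Lemma factorisation_space_subset C C' :
  C `<=` C' -> factorisation_space R E C `<=` factorisation_space R E C'.
Proof.
move=> CC' f [f0 [n [a [g [fina Ca g0 fg]]]]].
split=> //; exists n, a, g; split=> // k.
by have [b /CC' C'b ab] := Ca k; exists b.
Qed.

(** * Splitting along a coordinate *)

Section Reset.
Variable x0 : EI.

Definition reset (i : I) (x : EI) : EI :=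
  fun k => if `[< k = i >] then x0 k else x k.

Lemma depends_on_reset i a f :
  depends_on a f -> depends_on (a `\ i) (f \o reset i).
Proof.
move=> fa x y xy; apply: fa => k ak; rewrite /reset.
by case: asboolP => // ki; apply: xy.
Qed.

Lemma reset_id i a f x : depends_on a f -> ~ a i -> f (reset i x) = f x.
Proof.
move=> fa ai; apply: fa => k ak; rewrite /reset.
by case: asboolP => // ki; move: ak; rewrite ki.
Qed.

(** Resetting [i] removes it from the set of every factor. *)
Lemma factors_reset i C C' f : (forall a, C a -> C' (a `\ i)) ->
  factors C f -> factors C' (f \o reset i).
Proof.
move=> CC'; elim=> [|a {}f fina Ca f0 fa|{}f g _ Cf _ Cg].
- exact: factors1.
- apply: (@factors_single _ (a `\ i)); [exact: finite_setD|exact: CC'| |].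
    by move=> x; apply: f0.
  exact: depends_on_reset.
- exact: factorsM Cf Cg.
Qed.

(** Factors on sets that avoid [i] cancel against their reset, which is why [C']
    only has to contain the members of [C] through [i]. *)
Lemma factors_quotient i C C' f : (forall a, C a -> a i -> C' a) ->
  factors C f -> factors C' (fun x => f x / f (reset i x)).
Proof.
move=> CC'; elim=> [|a {}f fina Ca f0 fa|{}f g _ Cf _ Cg].
- by under eq_fun do rewrite divr1; apply: factors1.
- have [ai|ai] := pselect (a i).
    apply: (@factors_single _ a) => //; first exact: CC'.
      by move=> x; rewrite divr_gt0.
    move=> x y xy; rewrite (fa x y xy); congr (_ / _).
    by apply: (depends_on_reset fa) => k [ak _]; apply: xy.
  rewrite (_ : (fun x => _) = fun=> 1); first exact: factors1.
  by apply/funext => x; rewrite (reset_id _ fa ai) divff// gt_eqF.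
- rewrite (_ : (fun x => _) = fun x => f x / f (reset i x) * (g x / g (reset i x))).
    exact: factorsM Cf Cg.
  by apply/funext => x; rewrite invfM mulrACA.
Qed.

(** Quotients have already been taken along the coordinates in [b], and those in
    [s] remain to be split.  Once [s] is exhausted, [f] depends on [b] alone; if
    it is not [1], its factorisations show that each [A j] contains a superset
    of [b], hence [b] itself, and [f] is a single factor on [b]. *)
Lemma factors_bigcap_above (J : Type) (A : J -> set (set I)) (j0 : J)
    (s : seq {classic I}) b f :
  (forall j, lower_set (A j) `<=` A j) -> finite_set b ->
  depends_on (b `|` [set` s]) f ->
  (forall j, factors [set a | A j a /\ b `<=` a] f) ->
  factors (\bigcap_j A j) f.
Proof.
move=> lowA; elim: s b f => [|i s IHs] b f finb fbs Af.
  have [f1|f1] := pselect (f = fun=> 1); first by rewrite f1; apply: factors1.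
  apply: (@factors_single _ b) => //.
  - move=> j _; have [//|[a [Aa ba]]] := factors_one_or_nonempty (Af j).
    by apply: lowA; exists a.
  - exact: factors_gt0 (Af j0).
  - by apply: depends_on_subset fbs => k [].
have [bi|bi] := pselect (b i).
  apply: (IHs b) => //; apply: depends_on_subset fbs => k [bk|]; first by left.
  by rewrite /= inE => /orP[/eqP->|]; [left|right].
(* The first factor no longer depends on [i]; in the second one, every set
   now contains [i]. *)
rewrite (_ : f = fun x => (f \o reset i) x * (f x / f (reset i x))); last first.
  by apply/funext => x /=; rewrite mulrC divfK// gt_eqF// (factors_gt0 (Af j0)).
apply: factorsM.
  apply: (IHs b) => //.
    apply: depends_on_subset (depends_on_reset fbs) => k [[bk|]]; first by left.
    by rewrite /= inE => /orP[/eqP->//|]; right.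
  move=> j; apply: factors_reset (Af j) => a [Aa ba]; split.
    by apply: lowA; exists a => // k [].
  by move=> k bk; split; [exact: ba|move=> ki; apply: bi; rewrite -ki].
apply: (IHs (b `|` [set i])).
- by rewrite finite_setU.
- have bs : b `|` [set` i :: s] `<=` (b `|` [set i]) `|` [set` s].
    move=> k [bk|]; first by left; left.
    by rewrite /= inE => /orP[/eqP->|]; [left; right|right].
  move=> x y xy; rewrite (depends_on_subset bs fbs xy); congr (_ / _).
  by apply: (depends_on_reset (depends_on_subset bs fbs)) => k [+ _]; apply: xy.
- move=> j; apply: factors_quotient (Af j) => a [Aa ba] ai; split=> //.
  by move=> k [/ba//|->].
Qed.

End Reset.

Lemma factors_bigcap (J : Type) (A : J -> set (set I)) (j0 : J) f :
  (forall j, lower_set (A j) `<=` A j) ->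
  (forall j, factors (A j) f) -> factors (\bigcap_j A j) f.
Proof.
move=> lowA Af.
have [[x0 _]|noE] := pselect (exists x : EI, True); last first.
  rewrite (_ : f = fun=> 1); first exact: factors1.
  by apply/funext => x; case: noE; exists x.
have [s0 fins0 fs0] := factors_finite_support (Af j0).
have [s s0E] := (@finite_seqP {classic I} s0).1 fins0.
apply: (factors_bigcap_above x0 j0 (s := s) (b := set0)) => //.
  by rewrite set0U -s0E.
move=> j; rewrite (_ : [set a | _] = A j)//.
by apply/seteqP; split=> [a []//|a Aa]; split.
Qed.

End Factorisation.

Theorem theorem4p1 (R : realType) (I : Type) (E : I -> Type)
    (J : Type) (A : J -> set (set I)) :
  bigcap_or (factorisation_space R E setT)
            (fun j => factorisation_space R E (lower_set (A j)))
  = factorisation_space R E (\bigcap_j lower_set (A j)).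
Proof.
rewrite /bigcap_or; case: asboolP => [[j0]|noJ]; last first.
  congr factorisation_space; apply/seteqP; split=> // a _ j _.
  by case: noJ.
apply/seteqP; split=> f; last first.
  move=> Af j _; apply: factorisation_space_subset Af => a; exact.
move=> Af; rewrite factorisation_spaceE lower_set_bigcap /=.
apply: factors_bigcap => // [j|j]; first by rewrite lower_set_idem.
by move: (Af j Logic.I); rewrite factorisation_spaceE lower_set_idem.
Qed.
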